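(* Consider a power distribution network on a directed rooted tree with one slack bus (node $0$) and $n\ge1$ PQ loads (nodes $1,\dots,n$, each with positive active and reactive power demand), described by the relaxed branch flow model. At every operating point in the voltage stability region, $$\mathrm{VSI}\;\le\;\mathrm{VSIA}\;\le\;\mathrm{VSI}-\rho\,\ln(1-\rho),$$ where $\rho=\rho\big((\varphi_{u,\mathrm{diag}}')^{-1}\varphi_{u,\mathrm{off}}'\big)$, and $$\mathrm{VSI}=\frac{\ln(\det(\varphi_u'))}{n},\qquad \mathrm{VSIA}=\frac{\ln({\det}_{\mathrm{approx}})}{n},\qquad {\det}_{\mathrm{approx}}=\prod_{j=1}^n\varphi_{u,jj}'.$$
   Context: **Network.** $G=(N,E)$ is a directed tree with $N=\{0,1,\dots,n\}$ and root $0$; $(i,j)\in E$ means that $i$ is the parent of $j$. $\delta(i)$ is the set of children of $i$, and $\pi(j)$ is the unique parent of $j\neq0$. Each edge $(\pi(j),j)$ is indexed by its child node $j\in\{1,\dots,n\}$, and vectors indexed by $E$ are ordered accordingly. **Variables and parameters.** Each edge $(i,j)$ has impedance $r_{ij}+\mathbf{j}x_{ij}$ with $r_{ij},x_{ij}\ge0$, squared current magnitude $\ell_{ij}$, and sending-end active and reactive powers $p_{ij},q_{ij}$. Each node $i$ has squared voltage magnitude $v_i$ and active and reactive power demands $p_i,q_i$. Being squared magnitudes, $v_i$ and $\ell_{ij}$ are nonnegative. Stack these into $\overline p,\overline q,\ell,r,x\in\mathbb{R}^n$ (edge vectors) and $p,q,v\in\mathbb{R}^{n+1}$ (node vectors).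 $[y]$ is the diagonal matrix with diagonal $y$. **Matrices.** $A^i,A^o\in\{0,1\}^{(n+1)\times n}$: the row of $A^i$ for node $j$ has a $1$ exactly at the edge $(\pi(j),j)$ (row $0$ is zero); the row of $A^o$ for node $i$ has a $1$ exactly at the edges $(i,k)$, $k\in\delta(i)$. $A:=A^o-A^i$. $A_2,A_2^o$ are the $n\times n$ matrices obtained from $A,A^o$ by removing the first row (that of node $0$). **Relaxed branch flow model.** Let $u=(\overline p,\overline q,\ell,v_{1\ldots n},p_0,q_0)\in\mathbb{R}^{4n+2}$ and $\xi=(v_0,p_{1\ldots n},q_{1\ldots n})\in\mathbb{R}^{2n+1}$. The model is $\varphi(u,\xi)=\mathbf 0$, where $\varphi$ has the four blocks $$-A\overline p-A^i[r]\ell-p,\qquad -A\overline q-A^i[x]\ell-q,$$ $$A^Tv-2([r]\overline p+[x]\overline q)+([r]^2+[x]^2)\ell,\qquad [\overline p]\overline p+[\overline q]\overline q-[A^{oT}v]\ell .$$ Node $0$ is a slack bus, with $v_0=1$ imposed. The power flow Jacobian is $\varphi_u=\partial\varphi/\partial u\in\mathbb{R}^{(4n+2)\times(4n+2)}$. **Reduced power flow Jacobian.** The $n\times n$ matrix $$\varphi_u'=[A^{oT}v]+2[\overline p]A_2^{-1}[r]+2[\overline q]A_2^{-1}[x]-[\ell]A_2^{oT}(A_2^T)^{-1}\big([r]^2+2[r]A_2^{-1}[r]+[x]^2+2[x]A_2^{-1}[x]\big),$$ with entries $\varphi_{u,jk}'$. $\varphi_{u,\mathrm{diag}}'$ and $\varphi_{u,\mathrm{off}}'$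 are the matrices containing only its diagonal, respectively off-diagonal, entries, so $\varphi_u'=\varphi_{u,\mathrm{diag}}'+\varphi_{u,\mathrm{off}}'$. $\rho(\cdot)$ is the spectral radius. **PQ loads.** All PQ buses have positive active and reactive power demand: $p_j>0$, $q_j>0$ for $j=1,\dots,n$. **Voltage stability region.** The flat voltage solution is the solution of $\varphi(u,\xi)=\mathbf 0$ with $v=\mathbf 1$ and $p,q,\overline p,\overline q,\ell$ all zero. For a network of loads, the voltage stability region is the region surrounding the flat voltage solution on which $\det(\varphi_u)\neq 0$: the connected component containing the flat voltage solution of the set of all $(u,\xi)$ with $\varphi(u,\xi)=\mathbf 0$, $v_0=1$, $v\ge\mathbf 0$, $\ell\ge\mathbf 0$, $p_j,q_j\ge0$ for $j=1,\dots,n$ (the closure of the load assumption, so as to include the flat solution), and $\det(\varphi_u)\ne0$. The claim concerns the points of this region with $p_j,q_j>0$ for all $j=1,\dots,n$. *)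

(* Defs.v *)
From mathcomp Require Import all_boot all_order all_algebra.
From mathcomp Require Import complex.
From mathcomp Require Import all_classical all_reals all_analysis.

Set Implicit Arguments.
Unset Strict Implicit.
Unset Printing Implicit Defensive.

Import Order.TTheory GRing.Theory Num.Theory.
Import numFieldNormedType.Exports.

Local Open Scope classical_set_scope.
Local Open Scope ring_scope.

(* Nodes are 'I_n.+1 with root ord0; [E i j] means that i is the parent of j.
   The edge entering the non-root node [lift ord0 k] is indexed by k : 'I_n. *)
Definition rooted_tree (n : nat) (E : rel 'I_n.+1) : Prop :=
  [/\ forall i, ~~ E i ord0,
      forall j, j != ord0 -> exists! i, E i j
    & forall j, connect E ord0 j].

Section BranchFlow.
Variables (R : realType) (n : nat).

Definition diagc (y : 'cV[R]_n) : 'M[R]_n := diag_mx y^T.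

Section Incidence.
Variable E : rel 'I_n.+1.

Definition Ain : 'M[R]_(n.+1, n) := \matrix_(j, k) (j == lift ord0 k)%:R.
Definition Aout : 'M[R]_(n.+1, n) := \matrix_(i, k) (E i (lift ord0 k))%:R.
Definition Ainc : 'M[R]_(n.+1, n) := Aout - Ain.
Definition Ainc2 : 'M[R]_n := row' ord0 Ainc.
Definition Aout2 : 'M[R]_n := row' ord0 Aout.

End Incidence.

(* u stacks (pbar, qbar, ell, v_1..n, p_0, q_0); xi stacks (v_0, p_1..n, q_1..n). *)
Definition dim_u : nat := n + (n + (n + (n + (1 + 1)))).
Definition dim_xi : nat := 1 + (n + n).

Section Projections.
Variables (u : 'cV[R]_dim_u) (xi : 'cV[R]_dim_xi).

Definition pbar : 'cV[R]_n := usubmx u.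
Definition qbar : 'cV[R]_n := usubmx (dsubmx u).
Definition ell : 'cV[R]_n := usubmx (dsubmx (dsubmx u)).
Definition v_pq : 'cV[R]_n := usubmx (dsubmx (dsubmx (dsubmx u))).
Definition p_root : 'cV[R]_1 := usubmx (dsubmx (dsubmx (dsubmx (dsubmx u)))).
Definition q_root : 'cV[R]_1 := dsubmx (dsubmx (dsubmx (dsubmx (dsubmx u)))).
Definition v_root : 'cV[R]_1 := usubmx xi.
Definition p_pq : 'cV[R]_n := usubmx (dsubmx xi).
Definition q_pq : 'cV[R]_n := dsubmx (dsubmx xi).

Definition v_node : 'cV[R]_n.+1 := col_mx v_root v_pq.
Definition p_node : 'cV[R]_n.+1 := col_mx p_root p_pq.
Definition q_node : 'cV[R]_n.+1 := col_mx q_root q_pq.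

End Projections.

(* The four blocks of phi have heights n+1, n+1, n, n; the cast makes the
   Jacobian with respect to u literally square. *)
Lemma dim_phi : (n.+1 + (n.+1 + (n + n)))%N = dim_u.
Proof. by rewrite /dim_u !addSn !addnS !addn0 !addnA. Qed.

Section Model.
Variables (E : rel 'I_n.+1) (r x : 'cV[R]_n).

Definition phi (u : 'cV[R]_dim_u) (xi : 'cV[R]_dim_xi) : 'cV[R]_dim_u :=
  castmx (dim_phi, erefl 1%N)
    (col_mx (- (Ainc E *m pbar u) - Ain *m diagc r *m ell u - p_node u xi)
    (col_mx (- (Ainc E *m qbar u) - Ain *m diagc x *m ell u - q_node u xi)
    (col_mx ((Ainc E)^T *m v_node u xi
               - 2 *: (diagc r *m pbar u + diagc x *m qbar u)
               + (diagc r *m diagc r + diagc x *m diagc x) *m ell u)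
            (diagc (pbar u) *m pbar u + diagc (qbar u) *m qbar u
               - diagc ((Aout E)^T *m v_node u xi) *m ell u)))).

Definition phi_u (u : 'cV[R]_dim_u) (xi : 'cV[R]_dim_xi) : 'M[R]_dim_u :=
  \matrix_(i, j) 'D_(delta_mx j 0) (fun w : 'cV[R]_dim_u => phi w xi i 0 : R^o) u.

Definition phi_u_red (u : 'cV[R]_dim_u) (xi : 'cV[R]_dim_xi) : 'M[R]_n :=
  let A2i := invmx (Ainc2 E) in
  diagc ((Aout E)^T *m v_node u xi)
  + 2 *: (diagc (pbar u) *m A2i *m diagc r)
  + 2 *: (diagc (qbar u) *m A2i *m diagc x)
  - diagc (ell u) *m (Aout2 E)^T *m invmx (Ainc2 E)^T
    *m (diagc r *m diagc r + 2 *: (diagc r *m A2i *m diagc r)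
        + diagc x *m diagc x + 2 *: (diagc x *m A2i *m diagc x)).

Definition flat_u : 'cV[R]_dim_u :=
  col_mx 0 (col_mx 0 (col_mx 0 (col_mx (const_mx 1) 0))).
Definition flat_xi : 'cV[R]_dim_xi := col_mx (const_mx 1) 0.

(* Loads are only required nonnegative here, so that the flat solution belongs to
   the set; the slack demands p_0, q_0 are unconstrained. *)
Definition regular_load_solutions : set ('cV[R]_dim_u * 'cV[R]_dim_xi) :=
  [set s | phi s.1 s.2 = 0
        /\ v_root s.2 = const_mx 1
        /\ (forall i, 0 <= v_node s.1 s.2 i 0)
        /\ (forall k, 0 <= ell s.1 k 0)
        /\ (forall k, 0 <= p_pq s.2 k 0 /\ 0 <= q_pq s.2 k 0)
        /\ \det (phi_u s.1 s.2) != 0].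

Definition stability_region : set ('cV[R]_dim_u * 'cV[R]_dim_xi) :=
  connected_component regular_load_solutions (flat_u, flat_xi).

End Model.

Definition diag_part (M : 'M[R]_n) : 'M[R]_n :=
  \matrix_(i, j) (if i == j then M i j else 0).
Definition off_part (M : 'M[R]_n) : 'M[R]_n :=
  \matrix_(i, j) (if i == j then 0 else M i j).

(* The eigenvalues are the complex ones. *)
Definition spectral_radius (M : 'M[R]_n) : R :=
  sup [set Normc.normc z | z in
        [set z : complex R | eigenvalue (map_mx (real_complex R) M) z]].

Definition VSI (M : 'M[R]_n) : R := ln (\det M) / n%:R.
Definition det_approx (M : 'M[R]_n) : R := \prod_j M j j.
Definition VSIA (M : 'M[R]_n) : R := ln (det_approx M) / n%:R.

End BranchFlow.

(* Main.v *)
Require Import Defs.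
From mathcomp Require Import all_boot all_order all_algebra.
From mathcomp Require Import complex.
From mathcomp Require Import all_classical all_reals all_analysis.
From mathcomp Require Import ring lra.

(** The statement is a fact about M-matrices. Call a matrix with nonpositive
    off-diagonal entries a Z-matrix, and a nonsingular M-matrix a Z-matrix M
    with M y > 0 for some vector y > 0 ([semipositive]).

    On the whole solution set, nonnegative loads force nonnegative line flows
    (each flow is the sum of the demands and losses downstream of it), and this
    makes the reduced Jacobian M a Z-matrix ([phi_u_red_Zmatrix]). Moreover M is
    invertible wherever the full Jacobian is, because a kernel vector of M is the
    current component of a kernel vector of the full Jacobian
    ([phi_u_red_unit]). Among invertible Z-matrices, being semipositive is an
    open condition, and it is also closed, since it is equivalent to having a
    nonnegative inverse. At the flat solution M is the identity matrix, so
    connectedness makes M a nonsingular M-matrix on the whole stability region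
    ([semipositive_component]).

    For a nonsingular M-matrix, eliminating one variable at a time gives
    0 < det M <= product of the diagonal ([Z_semipositive_det]), which is
    VSI <= VSIA. For the other bound, write M = D (1 + J) with D the diagonal
    part. The inequality M y > 0 says that |J| contracts the y-weighted maximum
    norm, so the spectral radius rho of J is less than 1. As J has zero trace,
    its eigenvalues z sum to 0, and ln |1 + z| - Re z >= rho ln (1 - rho) for
    each of them; summing yields ln det (1 + J) >= n rho ln (1 - rho)
    ([ln_det1D_ge]). *)

Set Implicit Arguments.
Unset Strict Implicit.
Unset Printing Implicit Defensive.

Import Order.TTheory GRing.Theory Num.Theory.
Import numFieldNormedType.Exports.
Local Open Scope classical_set_scope.
Local Open Scope ring_scope.

(** * Nonsingular M-matrices *)

Section ZMatrix.
Variable F : realFieldType.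

Definition Zmatrix n (M : 'M[F]_n) := forall i j, i != j -> M i j <= 0.
Definition semipositive n (M : 'M[F]_n) :=
  exists2 y : 'cV[F]_n,
    forall i, 0 < y i 0 & forall i, 0 < (M *m y) i 0.
Definition monotone_mx n (M : 'M[F]_n) :=
  forall x : 'cV[F]_n, (forall i, 0 <= (M *m x) i 0) -> forall i, 0 <= x i 0.

(** If x had a negative entry, then at an index k minimizing x / y the row k of M
    would be negative on x: subtracting the right multiple of y from x leaves a
    nonnegative vector vanishing at k, on which row k is nonpositive. *)
Lemma Z_semipositive_monotone n (M : 'M[F]_n) :
  Zmatrix M -> semipositive M -> monotone_mx M.
Proof.
move=> Z [y y0 My0] x Mx0 i0.
pose f i := x i 0 / y i 0.
have [k kmin] : exists k, forall j, f k <= f j.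
  by case: (arg_minP f (erefl : xpredT i0)) => k _ kmin; exists k => j; apply: kmin.
suff : 0 <= f k.
  move=> fk; have := le_trans fk (kmin i0).
  by rewrite /f pmulr_lge0 // invr_gt0.
rewrite leNgt; apply/negP => fk.
pose z := x - f k *: y.
have z0 i : 0 <= z i 0.
  rewrite !mxE subr_ge0; have := kmin i.
  by rewrite {2}/f ler_pdivlMr.
have zk : z k 0 = 0 by rewrite !mxE /f divfK ?subrr// gt_eqF.
have : (M *m z) k 0 <= 0.
  rewrite mxE sumr_le0// => j _.
  have [->|kj] := eqVneq j k; first by rewrite zk mulr0.
  by rewrite mulr_le0_ge0// Z// eq_sym.
have -> : (M *m z) k 0 = (M *m x) k 0 - f k * (M *m y) k 0.
  by rewrite mulmxBr -scalemxAr; move: (M *m x) (M *m y) => a b; rewrite !mxE.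
apply/negP; rewrite -ltNge subr_gt0.
by apply: lt_le_trans (Mx0 k); rewrite nmulr_rlt0.
Qed.

Lemma monotone_unitmx n (M : 'M[F]_n) : monotone_mx M -> M \in unitmx.
Proof.
move=> mono; rewrite -unitmx_tr -row_free_unit; apply: inj_row_free => v vM.
have Mv : M *m v^T = 0 by rewrite -[M]trmxK -trmx_mul vM trmx0.
apply/rowP => j; apply/eqP; rewrite mxE eq_le -[v 0 j <= 0]oppr_ge0.
have H1 : 0 <= (- v^T) j 0 by apply: mono => i; rewrite mulmxN Mv oppr0 mxE.
have H2 : 0 <= v^T j 0 by apply: mono => i; rewrite Mv mxE.
by rewrite !mxE in H1 H2; rewrite H1 H2.
Qed.

Lemma monotone_rinv_ge0 n (M B : 'M[F]_n) :
  monotone_mx M -> M *m B = 1%:M -> forall i j, 0 <= B i j.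
Proof.
move=> mono MB i j; have -> : B i j = col j B i 0 by rewrite mxE.
apply: mono => k; rewrite colE mulmxA MB mul1mx mxE.
exact: ler0n.
Qed.

(** The witness is the vector of row sums of the inverse: each of them is
    positive because no row of an invertible matrix vanishes. *)
Lemma invmx_ge0_semipositive n (M : 'M[F]_n) :
  M \in unitmx -> (forall i j, 0 <= invmx M i j) -> semipositive M.
Proof.
move=> Mu iM0; exists (invmx M *m const_mx 1) => i; last first.
  by rewrite mulKVmx // mxE.
rewrite mxE lt_neqAle eq_sym sumr_ge0 ?andbT; last by move=> j _; rewrite mxE mulr1.
rewrite psumr_neq0; last by move=> j _; rewrite mxE mulr1.
apply/negPn/negP => /hasPn nh.
have /matrixP/(_ i i) : invmx M *m M = 1%:M by rewrite mulVmx.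
rewrite !mxE eqxx big1 => [/eqP|j _]; first by rewrite eq_sym oner_eq0.
have := nh j (mem_index_enum j); rewrite mxE mulr1 lt_neqAle iM0 !andbT negbK.
by move=> /eqP <-; rewrite mul0r.
Qed.

Lemma Z_semipositive_diag_gt0 n (M : 'M[F]_n) :
  Zmatrix M -> semipositive M -> forall i, 0 < M i i.
Proof.
move=> Z [y y0 My0] i; rewrite -(pmulr_lgt0 _ (y0 i)).
apply: lt_le_trans (My0 i) _; rewrite mxE (bigD1 i)//= gerDl sumr_le0// => j ji.
by rewrite mulr_le0_ge0 ?Z 1?eq_sym// ltW.
Qed.

(** Gaussian elimination of the first variable: the Schur complement S is again
    a semipositive Z-matrix, its diagonal is at most that of M, and
    det M = a * det S where a is the first pivot. *)
Lemma Z_semipositive_det n (M : 'M[F]_n) :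
  Zmatrix M -> semipositive M -> 0 < \det M <= \prod_i M i i.
Proof.
elim: n M => [|n IHn] M Z sp; first by rewrite det_mx00 big_ord0 ltr01 lexx.
have d0 := Z_semipositive_diag_gt0 Z sp.
move: Z sp d0; rewrite -(@submxK _ 1 n 1 n M).
move: (@ulsubmx _ 1 n 1 n M) (@ursubmx _ 1 n 1 n M) (@dlsubmx _ 1 n 1 n M)
  (@drsubmx _ 1 n 1 n M) => A b c D.
move=> {}Z [y y0 My0] d0.
pose a := A 0 0; have Aa : A = a%:M by rewrite [A]mx11_scalar.
have a0 : 0 < a by rewrite /a -(block_mxEul A b c D); apply: d0.
have b0 k : b 0 k <= 0.
  by rewrite -(block_mxEur A b c D); apply: Z; rewrite (@eq_lrshift 1 n).
have c0 k : c k 0 <= 0.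
  by rewrite -(block_mxEdl A b c D); apply: Z; rewrite (@eq_rlshift 1 n).
pose S := D - a^-1 *: (c *m b).
have SE j k : S j k = D j k - a^-1 * (c j 0 * b 0 k).
  by rewrite !mxE big_ord1.
have SD j k : S j k <= D j k.
  by rewrite SE gerBl mulr_ge0 ?invr_ge0 ?(ltW a0)// mulr_le0.
(* Column operations by a unipotent matrix make the block matrix lower triangular. *)
have detM : \det (block_mx A b c D) = a * \det S.
  have := det_ublock (1%:M : 'M[F]_1) (- (a^-1 *: b)) (1%:M : 'M[F]_n).
  rewrite !det1 mulr1 => dU.
  rewrite -[LHS]mulr1 -dU -det_mulmx mulmx_block !mulmx1 !mulmx0 !addr0.
  rewrite Aa mul_scalar_mx scalerN scalerA divff ?gt_eqF// scale1r addNr.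
  rewrite mulmxN -scalemxAr [X in block_mx _ _ _ X]addrC det_lblock.
  by rewrite det_scalar1.
have ZS : Zmatrix S.
  move=> j k jk; apply: le_trans (SD j k) _.
  by rewrite -(block_mxEdr A b c D); apply: Z; rewrite (@eq_rshift 1 n).
have spS : semipositive S.
  pose y1 := usubmx (y : 'cV_(1 + n)); pose y2 := dsubmx (y : 'cV_(1 + n)).
  exists y2 => j; first by rewrite mxE.
  have My : block_mx A b c D *m y = col_mx (A *m y1 + b *m y2) (c *m y1 + D *m y2).
    by rewrite -mul_block_col vsubmxK.
  have h1 := My0 (lshift n (0 : 'I_1)); have h2 := My0 (rshift 1 j).
  move: h1 h2; rewrite My (@col_mxEu _ 1 n) (@col_mxEd _ 1 n) => h1 h2.
  have cy : (c *m y1) j 0 = c j 0 * y1 0 0 by rewrite mxE big_ord1.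
  rewrite Aa mul_scalar_mx in h1.
  have {h1} : 0 < a * y1 0 0 + (b *m y2) 0 0 by move: h1; rewrite !mxE.
  have {h2} : 0 < c j 0 * y1 0 0 + (D *m y2) j 0 by rewrite -cy; move: h2; rewrite !mxE.
  have -> : (S *m y2) j 0 = (D *m y2) j 0 - a^-1 * (c j 0 * (b *m y2) 0 0).
    by rewrite mulmxBl -scalemxAl -mulmxA !mxE big_ord1 !mxE.
  set t := (b *m y2) 0 0; move=> h2 h1.
  apply: (lt_le_trans h2); rewrite addrC lerD2l -subr_ge0.
  have -> : - (a^-1 * (c j 0 * t)) - c j 0 * y1 0 0
     = - c j 0 * (a^-1 * (a * y1 0 0 + t)).
    by field; rewrite gt_eqF.
  rewrite mulr_ge0 ?oppr_ge0//.
  by rewrite mulr_ge0 ?invr_ge0 ?ltW.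
have /andP[dS0 dSle] := IHn S ZS spS.
rewrite detM mulr_gt0//= big_ord_recl.
have -> : block_mx A b c D ord0 ord0 = a.
  have := block_mxEul A b c D 0 0.
  by rewrite (_ : lshift n (0 : 'I_1) = ord0)//; apply: val_inj.
rewrite ler_pM2l//; apply: (le_trans dSle).
apply: ler_prod => i _; rewrite ltW ?Z_semipositive_diag_gt0//=.
have -> : block_mx A b c D (lift ord0 i) (lift ord0 i) = D i i.
  by have := block_mxEdr A b c D i i; rewrite (_ : rshift 1 i = lift ord0 i)//; apply: val_inj.
exact: SD.
Qed.

End ZMatrix.

(** * Determinants of trace-free perturbations of the identity *)

Section Spectral.
Variable R : realType.
Local Notation C := (complex R).
Local Notation toC := (real_complex R).

Lemma ln_ge_1B (y : R) : 0 < y -> 1 - y^-1 <= ln y.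
Proof.
move=> y0; have := @le_ln1Dx R (y^-1 - 1).
rewrite ltrBDl subrr invr_gt0 => /(_ y0); rewrite addrC subrK lnV ?posrE//.
lra.
Qed.

(** The right-hand side is least at a = rho, where it is ln (1 - rho) + rho. The
    weaker bound stated here follows directly from ln y >= 1 - 1 / y: for a >= 0
    it holds with rho replaced by a, for a = - t < 0 with rho replaced by t, and
    t * ln (1 - t) decreases as t grows in [0, 1[. *)
Lemma rho_ln_le (rho a : R) : `|a| <= rho -> rho < 1 ->
  rho * ln (1 - rho) <= ln (1 - a) + a.
Proof.
move=> arho rho1; have a1 := le_lt_trans arho rho1.
have a0 := normr_ge0 a.
have mono : rho * ln (1 - rho) <= `|a| * ln (1 - `|a|).
  rewrite -lerN2 -!mulrN ler_pM//.
    by rewrite oppr_ge0 ln_le0//; lra.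
  by rewrite lerN2 ler_ln ?posrE; lra.
apply: (le_trans mono).
have [a_ge0|a_lt0] := leP 0 a.
  rewrite ger0_norm// in a1 *.
  have p : 0 < 1 - a by lra.
  have := ln_ge_1B p; rewrite -(ler_pM2l p).
  rewrite mulrBr mulr1 divff ?gt_eqF//; nra.
move: a1; rewrite ltr0_norm//.
have [t Ea] : exists t, a = - t by exists (- a); rewrite opprK.
move: a_lt0; rewrite Ea oppr_lt0 => t0; rewrite !opprK => t1.
have l1 : ln (1 - t) <= - t by apply: le_ln1Dx; lra.
have l2 : t - t ^+ 2 <= ln (1 + t).
  apply: le_trans (ln_ge_1B _); last by lra.
  rewrite -subr_ge0.
  have -> : 1 - (1 + t)^-1 - (t - t ^+ 2) = t ^+ 3 / (1 + t).
    by field; rewrite gt_eqF //; lra.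
  by rewrite divr_ge0 ?exprn_ge0//; lra.
have l3 : t * ln (1 - t) <= t * - t by rewrite ler_pM2l.
rewrite expr2 in l2; lra.
Qed.

Lemma eigenvalue_seq n (A : 'M[C]_n) : exists s : seq C,
  [/\ size s = n, forall z, (z \in s) = eigenvalue A z,
     \tr A = \sum_(z <- s) z & \det (1%:M + A) = \prod_(z <- s) (1 + z)].
Proof.
have [s Es] := closed_field_poly_normal (char_poly A).
rewrite (monicP (char_poly_monic A)) scale1r in Es.
have szs : size s = n.
  by have := size_char_poly A; rewrite Es size_prod_XsubC => -[].
exists s; split => //.
- by move=> z; rewrite eigenvalue_root_char Es root_prod_XsubC.
- case: n A Es szs => [|n] A Es szs.
    by rewrite (size0nil szs) big_nil /mxtrace big_ord0.
  have := char_poly_trace A (ltn0Sn n); rewrite Es -[n.+1.-1]/(n.+1.-1) -{1}szs.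
  rewrite coefPn_prod_XsubC ?szs// => /eqP.
  by rewrite eqr_opp => /eqP.
have := congr1 (fun p => p.[-1]) Es.
rewrite horner_prod /=.
under [X in _ = X -> _]eq_bigr do rewrite hornerXsubC -opprD -mulN1r.
rewrite big_split /= big_const_seq count_predT szs iter_mulr_1.
have -> : (char_poly A).[-1] = (-1) ^+ n * \det (1%:M + A).
  rewrite /char_poly -horner_evalE -det_map_mx -detZ; congr (\det _).
  apply/matrixP => i j; rewrite !mxE /= horner_evalE !hornerE.
  by rewrite hornerMn hornerX; case: eqP => _ /=; ring.
by move/(mulfI (negbT (signr_eq0 _ _))).
Qed.

(** Pairing a left eigenvector with the positive weights y bounds its eigenvalue by
    the weighted maximum norm of A. *)
Lemma eigenvalue_le_weighted n (A : 'M[R]_n) (y : 'cV[R]_n) (c : R) (z : C) :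
    (forall i, 0 < y i 0) -> (forall i, \sum_j `|A i j| * y j 0 <= c * y i 0) ->
  eigenvalue (map_mx toC A) z -> Normc.normc z <= c.
Proof.
move=> y0 Ay /eigenvalueP [w wA w0]; rewrite -lecR.
change (`|z| <= toC c).
have yC i : 0 < toC (y i 0) by rewrite -[0]/(toC 0) ltcR.
pose S := \sum_j `|w 0 j| * toC (y j 0).
have S_gt0 : 0 < S.
  rewrite lt_neqAle eq_sym sumr_ge0 ?andbT; last by move=> j _; rewrite mulr_ge0 ?(ltW (yC _)).
  apply: contraNneq w0 => S0; apply/eqP/rowP => j; rewrite mxE; apply/eqP.
  have /eqP := S0; rewrite psumr_eq0 => [/allP /(_ j (mem_index_enum j))|i _].
    by rewrite mulf_eq0 (gt_eqF (yC j)) orbF normr_eq0.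
  by rewrite mulr_ge0 ?(ltW (yC _)).
rewrite -(ler_pM2r S_gt0) {1}/S mulr_sumr.
apply: (@le_trans _ _ (\sum_j \sum_i `|w 0 i| * toC (`|A i j| * y j 0))).
  apply: ler_sum => j _; rewrite mulrA -normrM.
  have -> : z * w 0 j = (w *m map_mx toC A) 0 j by rewrite wA mxE.
  rewrite mxE; under [leRHS]eq_bigr do rewrite rmorphM mulrA.
  rewrite -mulr_suml ler_wpM2r ?(ltW (yC j))//.
  apply: (le_trans (ler_norm_sum _ _ _)); apply: ler_sum => i _.
  rewrite normrM mxE ler_wpM2l//.
  by rewrite normc_def /= expr0n addr0 sqrtr_sqr.
rewrite exchange_big /= /S mulr_sumr; apply: ler_sum => i _.
rewrite -mulr_sumr mulrCA ler_wpM2l// -rmorphM -rmorph_sum lecR.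
exact: Ay.
Qed.

(** The spectral radius is a supremum, so a bound strictly below 1 has to be
    uniform over the eigenvalues. *)
Lemma strict_weighted_uniform n (A : 'M[R]_n) (y : 'cV[R]_n) :
    (forall i, 0 < y i 0) -> (forall i, \sum_j `|A i j| * y j 0 < y i 0) ->
  exists2 c, c < 1 & forall i, \sum_j `|A i j| * y j 0 <= c * y i 0.
Proof.
move=> y0 Ay; pose f i := (\sum_j `|A i j| * y j 0) / y i 0.
exists (\big[Num.max/0]_i f i).
  by apply: bigmax_lt => // i _; rewrite ltr_pdivrMr// mul1r.
by move=> i; rewrite -ler_pdivrMr//; apply: le_bigmax.
Qed.

Section Radius.
Variables (n : nat) (A : 'M[R]_n) (y : 'cV[R]_n).
Hypothesis n_gt0 : (0 < n)%N.
Hypothesis y_gt0 : forall i, 0 < y i 0.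
Hypothesis Ay_lt : forall i, \sum_j `|A i j| * y j 0 < y i 0.

Lemma eigenvalue_exists : exists z, eigenvalue (map_mx toC A) z.
Proof.
have [[|z s] [szs sE _ _]] := eigenvalue_seq (map_mx toC A).
  by have := n_gt0; rewrite -{1}szs.
by exists z; rewrite -sE mem_head.
Qed.

Lemma spectral_radius_lt1 : spectral_radius A < 1.
Proof.
have [c c1 Ac] := strict_weighted_uniform y_gt0 Ay_lt.
apply: le_lt_trans c1; apply: ge_sup.
  by have [z zA] := eigenvalue_exists; exists (Normc.normc z); exists z.
by move=> _ [z zA <-]; apply: eigenvalue_le_weighted Ac zA.
Qed.

Lemma eigenvalue_le_spectral_radius z :
  eigenvalue (map_mx toC A) z -> Normc.normc z <= spectral_radius A.
Proof.
have [c c1 Ac] := strict_weighted_uniform y_gt0 Ay_lt.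
move=> zA; apply: ub_le_sup; last by exists z.
by exists c => _ [w wA <-]; apply: eigenvalue_le_weighted Ac wA.
Qed.

(** The trace condition makes the linear terms Re z cancel in the product of the
    factors |1 + z|, leaving only the contribution of rho_ln_le to each. *)
Lemma ln_det1D_ge : \tr A = 0 -> 0 < \det (1%:M + A) ->
  n%:R * (spectral_radius A * ln (1 - spectral_radius A)) <= ln (\det (1%:M + A)).
Proof.
move=> trA detA; set rho := spectral_radius A.
have rho1 : rho < 1 := spectral_radius_lt1.
have [s [szs sE trs dets]] := eigenvalue_seq (map_mx toC A).
have Re_le z : z \in s -> `|complex.Re z| <= rho.
  rewrite sE => /eigenvalue_le_spectral_radius; apply: le_trans.
  by rewrite -lecR; apply: normc_ge_Re.
have factor z : z \in s ->
    expR (rho * ln (1 - rho) + complex.Re z) <= Normc.normc (1 + z).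
  move=> zs; have Rez := Re_le z zs.
  have p : 0 < 1 + complex.Re z by move: Rez; rewrite ler_norml => /andP[]; lra.
  apply: (@le_trans _ _ (1 + complex.Re z)).
    rewrite -ler_ln ?posrE ?expR_gt0// expRK.
    have := @rho_ln_le rho (- complex.Re z); rewrite normrN opprK => /(_ Rez rho1); lra.
  have -> : 1 + complex.Re z = complex.Re (1 + z) by case: (z).
  apply: le_trans (ler_norm _) _.
  by rewrite -lecR; apply: normc_ge_Re.
have sumRe : \sum_(z <- s) complex.Re z = 0.
  have -> : \sum_(z <- s) complex.Re z = complex.Re (\sum_(z <- s) z).
    by elim: s {szs sE trs dets Re_le factor} => [|[a b] s IHs];
      rewrite ?big_nil ?big_cons//= IHs; case: (\sum_(z <- s) z).
  by rewrite -trs trace_map_mx trA.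
have prod_le : expR (n%:R * (rho * ln (1 - rho))) <= \prod_(z <- s) Normc.normc (1 + z).
  have -> : n%:R * (rho * ln (1 - rho)) = \sum_(z <- s) (rho * ln (1 - rho) + complex.Re z).
    rewrite big_split /= sumRe addr0 big_const_seq count_predT szs.
    by rewrite iter_addr_0 mulr_natl.
  rewrite expR_sum big_seq [leRHS]big_seq.
  by apply: ler_prod => z zs; rewrite expR_ge0 factor.
rewrite -ler_expR lnK ?posrE//; apply: (le_trans prod_le).
have -> : \prod_(z <- s) Normc.normc (1 + z) = Normc.normc (\prod_(z <- s) (1 + z)).
  by rewrite (big_morph _ (@Normc.normcM R) (Normc.normc1 R)).
rewrite -dets -(map_mx1 toC) -map_mxD det_map_mx.
by rewrite /= expr0n addr0 sqrtr_sqr ger0_norm// ltW.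
Qed.

End Radius.

End Spectral.

(** * Determinant, diagonal and spectral radius of an M-matrix *)

Section Entries.
Variables (R : realType).

Lemma mxDE m n (A B : 'M[R]_(m, n)) i j : (A + B) i j = A i j + B i j.
Proof. by rewrite mxE. Qed.
Lemma mxNE m n (A : 'M[R]_(m, n)) i j : (- A) i j = - A i j.
Proof. by rewrite mxE. Qed.
Lemma mxZE m n a (A : 'M[R]_(m, n)) i j : (a *: A) i j = a * A i j.
Proof. by rewrite mxE. Qed.
Lemma diagc_mulE m n (y : 'cV[R]_m) (A : 'M[R]_(m, n)) i j :
  (diagc y *m A) i j = y i 0 * A i j.
Proof. by rewrite mul_diag_mx !mxE. Qed.
Definition entryE := (mxDE, mxNE, mxZE, diagc_mulE).

End Entries.

Section VSIBounds.
Variables (R : realType) (n : nat).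
Implicit Type M : 'M[R]_n.

Lemma invmx_diag_part_mul M (B : 'M[R]_n) : (forall i, M i i != 0) ->
  forall i j, (invmx (diag_part M) *m B) i j = (M i i)^-1 * B i j.
Proof.
move=> M0 i j; pose D := diagc (\col_i (M i i)^-1).
have DM : D *m diag_part M = 1%:M.
  apply/matrixP => a b; rewrite diagc_mulE !mxE.
  by case: eqP => [->|]; rewrite ?mulVf ?mulr0.
have [_ uM] := mulmx1_unit DM.
have -> : invmx (diag_part M) = D by rewrite -[LHS]mul1mx -DM mulmxK.
by rewrite diagc_mulE mxE.
Qed.

(** With M = D (1 + J), the y of semipositivity satisfies |J| y < y: dividing row i
    of M y > 0 by the diagonal entry says exactly that. *)
Lemma Z_semipositive_VSI M : (0 < n)%N -> Zmatrix M -> semipositive M ->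
  let rho := spectral_radius (invmx (diag_part M) *m off_part M) in
  (0 < \det M /\ 0 < det_approx M /\ rho < 1) /\
  VSI M <= VSIA M /\ VSIA M <= VSI M - rho * ln (1 - rho).
Proof.
move=> n0 Z sp; set J := invmx (diag_part M) *m off_part M => rho.
have d0 := Z_semipositive_diag_gt0 Z sp.
have dn0 i : M i i != 0 by rewrite gt_eqF.
have /andP[det0 detle] := Z_semipositive_det Z sp.
have da0 : 0 < det_approx M by apply: prodr_gt0 => i _.
have JE i j : J i j = (M i i)^-1 * (if i == j then 0 else M i j).
  by rewrite /J invmx_diag_part_mul// mxE.
have n_gt0 : 0 < n%:R :> R by rewrite ltr0n.
have [y y0 My] := sp.
have Jy i : \sum_j `|J i j| * y j 0 < y i 0.
  rewrite -(ltr_pM2l (d0 i)) mulr_sumr -subr_gt0; apply: lt_le_trans (My i) _.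
  rewrite mxE (bigD1 i)//= lerD2l -sumrN [leRHS](bigD1 i)//=.
  rewrite JE eqxx mulr0 normr0 mul0r mulr0 oppr0 add0r.
  apply: ler_sum => j ji; rewrite JE eq_sym (negPf ji) normrM.
  rewrite [`|M i j|]ler0_norm; last by rewrite Z// eq_sym.
  by rewrite gtr0_norm ?invr_gt0// mulrA mulVKf// mulNr opprK.
have trJ : \tr J = 0 by rewrite /mxtrace big1// => i _; rewrite JE eqxx mulr0.
have detE : \det M = det_approx M * \det (1%:M + J).
  have -> : det_approx M = \det (diagc (\col_i M i i)).
    by rewrite det_diag; apply: eq_bigr => i _; rewrite !mxE.
  rewrite -det_mulmx; congr (\det _); apply/matrixP => i j.
  rewrite diagc_mulE mxE mxDE JE [1%:M i j]mxE.
  have [->|ij] := eqVneq i j; first by rewrite mulr0 addr0 mulr1.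
  by rewrite add0r mulVKf.
have det1J : 0 < \det (1%:M + J) by rewrite -(pmulr_rgt0 _ da0) -detE.
have rho1 : rho < 1 by apply: (spectral_radius_lt1 n0 y0 Jy).
split; first by split.
split; first by rewrite ler_pM2r ?invr_gt0// ler_ln ?posrE.
have := ln_det1D_ge n0 y0 Jy trJ det1J; rewrite -/rho => lnge.
rewrite /VSIA /VSI detE lnM ?posrE// mulrDl -subr_ge0.
have : rho * ln (1 - rho) <= ln (\det (1%:M + J)) / n%:R.
  by rewrite ler_pdivlMr// mulrC.
lra.
Qed.

End VSIBounds.

(** * The incidence matrix of a rooted tree *)

Section IncidenceProducts.
Variables (R : realType).

Lemma col_mx_ord0 n (a : 'cV[R]_1) (z : 'cV[R]_n) :
  (col_mx a z : 'cV_n.+1) ord0 0 = a 0 0.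
Proof.
have -> : (ord0 : 'I_(1 + n)) = lshift n (0 : 'I_1) by apply: val_inj.
exact: (col_mxEu a z 0 0).
Qed.

Lemma col_mx_lift n (a : 'cV[R]_1) (z : 'cV[R]_n) k :
  (col_mx a z : 'cV_n.+1) (lift ord0 k) 0 = z k 0.
Proof.
have -> : (lift ord0 k : 'I_(1 + n)) = rshift 1 k by apply: val_inj.
exact: (col_mxEd a z k 0).
Qed.

Lemma tr_mul_col0 n (B : 'M[R]_(n.+1, n)) (z : 'cV[R]_n) :
  B^T *m (col_mx (0 : 'cV_1) z : 'cV_n.+1) = (row' ord0 B)^T *m z.
Proof.
apply/colP => k; rewrite mxE [RHS]mxE big_ord_recl col_mx_ord0 mxE.
rewrite [X in _ * X]mxE mulr0 add0r; apply: eq_bigr => j _.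
by rewrite col_mx_lift !mxE.
Qed.

Lemma Ainc_mul_lift n (E : rel 'I_n.+1) (z : 'cV[R]_n) k :
  (Ainc R E *m z) (lift ord0 k) 0 = (Ainc2 R E *m z) k 0.
Proof. by rewrite !mxE; apply: eq_bigr => j _; rewrite !mxE. Qed.

Lemma Ain_mul_lift n (z : 'cV[R]_n) k : (Ain R n *m z) (lift ord0 k) 0 = z k 0.
Proof.
rewrite mxE (bigD1 k)//= mxE eqxx mul1r big1 ?addr0// => j jk.
by rewrite mxE (inj_eq lift_inj) eq_sym (negPf jk) mul0r.
Qed.

Lemma castmx_eq0 m m' (e : m = m') (A : 'cV[R]_m) :
  castmx (e, erefl 1%N) A = 0 -> A = 0.
Proof. by case: _ / e; rewrite castmx_id. Qed.

End IncidenceProducts.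

Section Tree.
Variables (R : realType) (n : nat) (E : rel 'I_n.+1).
Hypothesis E_tree : rooted_tree E.
Local Notation A2 := (@Ainc2 R n E).
Local Notation P := (@Aout2 R n E).

(** Uniqueness of the parent turns multiplication by the transposed outgoing
    incidence matrix into evaluation at the parent. *)
Lemma sum_parent (f : 'I_n.+1 -> R) i j :
  E i j -> \sum_k (E k j)%:R * f k = f i.
Proof.
move=> Eij; have [noroot uniqp _] := E_tree.
have j0 : j != ord0 by apply: contraTneq Eij => ->; apply: noroot.
have [i' [_ i'u]] := uniqp j j0.
rewrite (bigD1 i)//= Eij mul1r big1 ?addr0// => k ki.
case: (boolP (E k j)) => [Ekj|]; last by rewrite mul0r.
by case/negP: ki; rewrite -(i'u _ Ekj) -(i'u _ Eij).
Qed.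

Lemma has_parent j : j != ord0 -> exists i, E i j.
Proof. by have [_ h _] := E_tree; move=> /h [i [Eij _]]; exists i. Qed.

Lemma Ainc2E : A2 = P - 1%:M.
Proof. by apply/matrixP => j k; rewrite !mxE (inj_eq lift_inj). Qed.

Lemma Aout2_ge0 j k : 0 <= P j k.
Proof. by rewrite !mxE ler0n. Qed.

(** The hypothesis says that x, extended by 0 at the root, does not decrease from
    parent to child; hence it is nonnegative along every path from the root. *)
Lemma NAinc2_tr_monotone : monotone_mx (- A2^T).
Proof.
move=> x Nx k; pose X i := oapp (fun k => x k 0) 0 (unlift ord0 i).
have X0 : X ord0 = 0 by rewrite /X unlift_none.
have XS m : X (lift ord0 m) = x m 0 by rewrite /X liftK.
have step i j : E i j -> X i <= X j.
  move=> Eij; have [noroot _ _] := E_tree.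
  case: (unliftP ord0 j) => [m jm|j0]; last by move: Eij; rewrite j0 (negPf (noroot i)).
  rewrite -(sum_parent X Eij) jm XS -subr_ge0.
  have := Nx m; congr (0 <= _).
  rewrite mulNmx mxE Ainc2E linearB/= mulmxBl trmx1 mul1mx mxE [(- x) _ _]mxE opprB.
  congr (_ - _); rewrite big_ord_recl X0 mulr0 add0r mxE.
  by apply: eq_bigr => i0 _; rewrite XS !mxE.
have pathX p i : path E i p -> 0 <= X i -> 0 <= X (last i p).
  elim: p i => //= j p IHp i /andP[Eij Ep] Xi; apply: IHp => //.
  exact: le_trans (step _ _ Eij).
have [_ _ conn] := E_tree; have /connectP[p Ep lastp] := conn (lift ord0 k).
by rewrite -XS lastp pathX// X0.
Qed.

Lemma Ainc2_unit : A2 \in unitmx.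
Proof.
have := monotone_unitmx NAinc2_tr_monotone.
by rewrite -scaleN1r unitmxZ ?unitrN1// unitmx_tr.
Qed.

(** The opposite of this inverse is the descendant matrix: its entry (i, j) is 1 if j
    lies in the subtree of i and 0 otherwise. *)
Lemma invmx_Ainc2_le0 i j : invmx A2 i j <= 0.
Proof.
have := @monotone_rinv_ge0 _ _ _ (- (invmx A2)^T) NAinc2_tr_monotone.
rewrite mulmxN mulNmx opprK -trmx_mul mulVmx ?Ainc2_unit// trmx1.
by move=> /(_ erefl j i); rewrite !mxE oppr_ge0.
Qed.

Lemma invmx_Ainc2_diag k : invmx A2 k k <= -1.
Proof.
have : A2 *m invmx A2 = 1%:M by rewrite mulmxV ?Ainc2_unit.
rewrite {1}Ainc2E mulmxBl mul1mx => /matrixP/(_ k k).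
rewrite mxDE mxNE [(_ *m _) k k]mxE [1%:M k k]mxE eqxx => H.
have : \sum_j P k j * invmx A2 j k <= 0.
  by apply: sumr_le0 => j _; rewrite mulr_ge0_le0 ?Aout2_ge0 ?invmx_Ainc2_le0.
move: H; rewrite /=; lra.
Qed.

End Tree.

(** * The power flow Jacobian and its reduction *)

Section PowerFlow.
Variables (R : realType) (n : nat) (E : rel 'I_n.+1).
Variables (r x : 'cV[R]_n).
Implicit Types (u d : 'cV[R]_(dim_u n)) (xi : 'cV[R]_(dim_xi n)).

(** The differential of phi E r x in u at (u, xi), applied to the direction d. *)
Definition phi_lin u xi d : 'cV[R]_(dim_u n) :=
  castmx (dim_phi n, erefl 1%N)
    (col_mx (- (Ainc R E *m pbar d) - Ain R n *m diagc r *m ell d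
               - (col_mx (p_root d) (0 : 'cV_n) : 'cV_n.+1))
    (col_mx (- (Ainc R E *m qbar d) - Ain R n *m diagc x *m ell d
               - (col_mx (q_root d) (0 : 'cV_n) : 'cV_n.+1))
    (col_mx ((Ainc R E)^T *m (col_mx (0 : 'cV_1) (v_pq d) : 'cV_n.+1)
               - 2 *: (diagc r *m pbar d + diagc x *m qbar d)
               + (diagc r *m diagc r + diagc x *m diagc x) *m ell d)
            (2 *: (diagc (pbar u) *m pbar d + diagc (qbar u) *m qbar d)
               - diagc ((Aout R E)^T *m v_node u xi) *m ell d
               - diagc ((Aout R E)^T *m (col_mx (0 : 'cV_1) (v_pq d) : 'cV_n.+1)) *m ell u)))).

(** The model is quadratic in u, and this is its homogeneous part of degree 2. *)
Definition phi_quad d : 'cV[R]_(dim_u n) :=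
  castmx (dim_phi n, erefl 1%N)
    (col_mx (0 : 'cV_n.+1) (col_mx (0 : 'cV_n.+1) (col_mx (0 : 'cV_n)
      (diagc (pbar d) *m pbar d + diagc (qbar d) *m qbar d
        - diagc ((Aout R E)^T *m (col_mx (0 : 'cV_1) (v_pq d) : 'cV_n.+1)) *m ell d)))).

Lemma castmxDZ m m' (e : m = m') a (A B : 'cV[R]_m) :
  castmx (e, erefl 1%N) (a *: A + B)
  = a *: castmx (e, erefl 1%N) A + castmx (e, erefl 1%N) B.
Proof. by case: _ / e; rewrite !castmx_id. Qed.

Lemma col_mxDZ m m' a (A B : 'cV[R]_m) (A' B' : 'cV[R]_m') :
  a *: col_mx A A' + col_mx B B' = col_mx (a *: A + B) (a *: A' + B').
Proof. by rewrite scale_col_mx add_col_mx. Qed.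

Lemma mulmxDZ m n' a (B : 'M[R]_(m, n')) (y z : 'cV[R]_n') :
  B *m (a *: y + z) = a *: (B *m y) + B *m z.
Proof. by rewrite mulmxDr scalemxAr. Qed.

Lemma pbarDZ a d u : pbar (a *: d + u) = a *: pbar d + pbar u.
Proof. by rewrite /pbar linearP. Qed.
Lemma qbarDZ a d u : qbar (a *: d + u) = a *: qbar d + qbar u.
Proof. by rewrite /qbar !linearP. Qed.
Lemma ellDZ a d u : ell (a *: d + u) = a *: ell d + ell u.
Proof. by rewrite /ell !linearP. Qed.
Lemma v_pqDZ a d u : v_pq (a *: d + u) = a *: v_pq d + v_pq u.
Proof. by rewrite /v_pq !linearP. Qed.
Lemma p_rootDZ a d u : p_root (a *: d + u) = a *: p_root d + p_root u.
Proof. by rewrite /p_root !linearP. Qed.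
Lemma q_rootDZ a d u : q_root (a *: d + u) = a *: q_root d + q_root u.
Proof. by rewrite /q_root !linearP. Qed.

Lemma p_nodeDZ a d u xi :
  p_node (a *: d + u) xi = a *: (col_mx (p_root d) (0 : 'cV_n) : 'cV_n.+1) + p_node u xi.
Proof. 
have := col_mxDZ a (p_root d) (p_root u) 0 (p_pq xi).
by rewrite scaler0 add0r /p_node p_rootDZ => <-. Qed.
Lemma q_nodeDZ a d u xi :
  q_node (a *: d + u) xi = a *: (col_mx (q_root d) (0 : 'cV_n) : 'cV_n.+1) + q_node u xi.
Proof. 
have := col_mxDZ a (q_root d) (q_root u) 0 (q_pq xi).
by rewrite scaler0 add0r /q_node q_rootDZ => <-. Qed.
Lemma v_nodeDZ a d u xi :
  v_node (a *: d + u) xi = a *: (col_mx (0 : 'cV_1) (v_pq d) : 'cV_n.+1) + v_node u xi.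
Proof. 
have := col_mxDZ a 0 (v_root xi) (v_pq d) (v_pq u).
by rewrite scaler0 add0r /v_node v_pqDZ => <-. Qed.

Definition uDZ := (pbarDZ, qbarDZ, ellDZ, v_pqDZ, p_rootDZ, q_rootDZ,
  p_nodeDZ, q_nodeDZ, v_nodeDZ, mulmxDZ).

Lemma phi_expand u xi d h :
  phi E r x (h *: d + u) xi
  = h *: (h *: phi_quad d + phi_lin u xi d) + phi E r x u xi.
Proof.
rewrite /phi /phi_lin /phi_quad -!castmxDZ !col_mxDZ !uDZ.
congr (castmx _ (col_mx _ (col_mx _ (col_mx _ _)))); apply/colP => i;
  rewrite !entryE ?(mxE, entryE) ; ring.
Qed.

Lemma phi_linDZ u xi a d e :
  phi_lin u xi (a *: d + e) = a *: phi_lin u xi d + phi_lin u xi e.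
Proof.
have col0DZ (y z : 'cV[R]_n) : (col_mx (0 : 'cV_1) (a *: y + z) : 'cV_n.+1)
    = a *: (col_mx (0 : 'cV_1) y : 'cV_n.+1) + (col_mx (0 : 'cV_1) z : 'cV_n.+1).
  by have := col_mxDZ a (0 : 'cV[R]_1) 0 y z; rewrite scaler0 addr0 => <-.
have colr0DZ (y z : 'cV[R]_1) : (col_mx (a *: y + z) (0 : 'cV_n) : 'cV_n.+1)
    = a *: (col_mx y (0 : 'cV_n) : 'cV_n.+1) + (col_mx z (0 : 'cV_n) : 'cV_n.+1).
  by have := col_mxDZ a y z (0 : 'cV[R]_n) 0; rewrite scaler0 addr0 => <-.
rewrite /phi_lin -!castmxDZ !col_mxDZ !uDZ col0DZ !colr0DZ !uDZ.
congr (castmx _ (col_mx _ (col_mx _ (col_mx _ _)))); apply/colP => i;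
  rewrite !entryE ?(mxE, entryE); ring.
Qed.

(** An exact second-order expansion along a line yields the derivative
    with no differentiability argument. *)
Lemma derive_quadratic_line (V : normedModType R) (f : V -> R^o) (v w : V) (a b : R) :
  (forall h : R, f (h *: w + v) = h * (h * b + a) + f v) -> 'D_w f v = a.
Proof.
move=> fE; rewrite /derive; apply: cvg_lim => //.
apply: (@cvg_trans _ ((fun h : R => h * b + a) @ (0 : R)^')).
  apply: near_eq_cvg; near=> h.
  rewrite /= fE addrK /GRing.scale /= mulKf//.
  by near: h; apply: nbhs_dnbhs_neq.
have : (fun h : R => h * b + a) x @[x --> (0 : R)] --> 0 * b + a.
  by apply: cvgD; [apply: cvgMl|apply: cvg_cst].
rewrite mul0r add0r; apply: cvg_trans; apply: cvg_app; exact: nbhs_dnbhs.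
Unshelve. all: by end_near.
Qed.

Lemma phi_u_mul u xi d : phi_u E r x u xi *m d = phi_lin u xi d.
Proof.
have phi_col j i : phi_u E r x u xi i j = phi_lin u xi (delta_mx j 0) i 0.
  rewrite mxE; apply: derive_quadratic_line => h.
  by rewrite phi_expand !entryE.
have lin0 : phi_lin u xi 0 = 0.
  by have := phi_linDZ u xi (-1) 0 0; rewrite scaler0 addr0 scaleN1r addNr.
have linD : {morph phi_lin u xi : y z / y + z}.
  by move=> y z; have := phi_linDZ u xi 1 y z; rewrite !scale1r.
have -> : d = \sum_j d j 0 *: delta_mx j 0.
  by rewrite [LHS]matrix_sum_delta; apply: eq_bigr => j _; rewrite big_ord1.
rewrite (big_morph _ linD lin0) mulmx_sumr; apply: eq_bigr => j _.
have := phi_linDZ u xi (d j 0) (delta_mx j 0) 0.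
rewrite addr0 lin0 addr0 => ->; rewrite -scalemxAr; congr (_ *: _).
by apply/colP => i; rewrite -phi_col -colE mxE.
Qed.

Hypothesis E_tree : rooted_tree E.
Local Notation A2 := (@Ainc2 R n E).

(** The linearized balance and voltage equations determine every other component of
    a direction d from its current component w; the last block of the
    differential then equals - M w. Hence a kernel vector of the reduced
    Jacobian extends to one of the full Jacobian. *)
Lemma phi_u_red_unit u xi :
  \det (phi_u E r x u xi) != 0 -> phi_u_red E r x u xi \in unitmx.
Proof.
move=> detJ; have A2u : A2 \in unitmx := Ainc2_unit R E_tree.
rewrite -unitmx_tr -row_free_unit; apply: inj_row_free => w' w'M.
pose w := w'^T; have Mw : phi_u_red E r x u xi *m w = 0.
  by rewrite -[X in X *m _]trmxK -trmx_mul w'M trmx0.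
suff w0 : w = 0 by rewrite -[w']trmxK -/w w0 trmx0.
pose dp := - (invmx A2 *m (diagc r *m w)).
pose dq := - (invmx A2 *m (diagc x *m w)).
pose c := 2 *: (diagc r *m dp + diagc x *m dq)
          - (diagc r *m diagc r + diagc x *m diagc x) *m w.
pose dv := invmx A2^T *m c.
pose dp0 : 'cV[R]_n.+1 := - (Ainc R E *m dp) - Ain R n *m diagc r *m w.
pose dq0 : 'cV[R]_n.+1 := - (Ainc R E *m dq) - Ain R n *m diagc x *m w.
pose d : 'cV[R]_(dim_u n) := col_mx dp (col_mx dq (col_mx w (col_mx dv
  (col_mx (const_mx (dp0 ord0 0)) (const_mx (dq0 ord0 0)))))).
have pd : pbar d = dp by rewrite /pbar col_mxKu.
have qd : qbar d = dq by rewrite /qbar col_mxKd col_mxKu.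
have ld : ell d = w by rewrite /ell !col_mxKd col_mxKu.
have vd : v_pq d = dv by rewrite /v_pq !col_mxKd col_mxKu.
have p0d : p_root d = const_mx (dp0 ord0 0) by rewrite /p_root !col_mxKd col_mxKu.
have q0d : q_root d = const_mx (dq0 ord0 0) by rewrite /q_root !col_mxKd.
suff d0 : d = 0 by rewrite -ld d0 /ell !linear0.
have Ju : phi_u E r x u xi \in unitmx by rewrite unitmxE unitfE.
suff : phi_lin u xi d = 0.
  by rewrite -phi_u_mul => Jd; rewrite -[d](mulKmx Ju) Jd mulmx0.
(* The free slack components absorb the balance at the root. *)
have rootrow (f g : 'cV[R]_n) : f = - (invmx A2 *m (diagc g *m w)) ->
    let z := - (Ainc R E *m f) - Ain R n *m diagc g *m w in
    z - (col_mx (const_mx (z ord0 0) : 'cV_1) (0 : 'cV_n) : 'cV_n.+1) = 0.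
  move=> fE z; apply/colP => i; rewrite [RHS]mxE.
  case: (unliftP ord0 i) => [k|] ->.
    rewrite !entryE col_mx_lift -mulmxA Ainc_mul_lift Ain_mul_lift fE.
    by rewrite mulmxN mulKVmx// !entryE opprK subrr sub0r mxE oppr0.
  by rewrite mxDE mxNE col_mx_ord0 [const_mx _ _ _]mxE subrr.
have third : (Ainc R E)^T *m (col_mx (0 : 'cV_1) dv : 'cV_n.+1)
    - 2 *: (diagc r *m dp + diagc x *m dq)
    + (diagc r *m diagc r + diagc x *m diagc x) *m w = 0.
  rewrite tr_mul_col0 -/(Ainc2 R E) /dv mulKVmx ?unitmx_tr// /c.
  by rewrite addrAC subrK subrr.
have fourth : 2 *: (diagc (pbar u) *m dp + diagc (qbar u) *m dq)
     - diagc ((Aout R E)^T *m v_node u xi) *m w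
     - diagc ((Aout R E)^T *m (col_mx (0 : 'cV_1) dv : 'cV_n.+1)) *m ell u
   = - (phi_u_red E r x u xi *m w).
  rewrite tr_mul_col0 -/(Aout2 R E).
  have cE : (diagc r *m diagc r + 2 *: (diagc r *m invmx A2 *m diagc r)
        + diagc x *m diagc x + 2 *: (diagc x *m invmx A2 *m diagc x)) *m w = - c.
    rewrite /c /dp /dq !mulmxDl -!scalemxAl !mulmxN -!mulmxA.
    by apply/colP => i; rewrite !entryE; ring.
  rewrite /phi_u_red mulmxBl -(mulmxA _ _ w) cE 2!(mulmxDl _ _ w) -!scalemxAl.
  rewrite /dp /dq -!mulmxA !mulmxN -/dv.
  by apply/colP => i; rewrite !entryE; ring.
rewrite /phi_lin pd qd ld vd p0d q0d (rootrow _ r erefl) (rootrow _ x erefl) third.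
rewrite fourth Mw oppr0 !col_mx0.
by case: _ / (dim_phi n); rewrite castmx_id.
Qed.

(** Flow conservation: f is the descendant matrix applied to losses plus demands. *)
Lemma flow_ge0 (f g L s : 'cV[R]_n) (a : 'cV[R]_1) :
    (forall k, 0 <= g k 0) -> (forall k, 0 <= L k 0) -> (forall k, 0 <= s k 0) ->
  - (Ainc R E *m f) - Ain R n *m diagc g *m L - (col_mx a s : 'cV_n.+1) = 0 ->
  forall k, 0 <= f k 0.
Proof.
move=> g0 L0 s0 bal k; have A2u : A2 \in unitmx := Ainc2_unit R E_tree.
have fE : A2 *m f = - (diagc g *m L + s).
  apply/colP => j; have /colP/(_ (lift ord0 j)) := bal.
  rewrite !entryE -mulmxA Ainc_mul_lift Ain_mul_lift col_mx_lift ?entryE [X in _ = X -> _]mxE.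
  lra.
rewrite -[f](mulKmx A2u) fE mulmxN mxNE mxE oppr_ge0 sumr_le0// => j _.
by rewrite mulr_le0_ge0 ?(invmx_Ainc2_le0 R E_tree)// !entryE addr_ge0 ?mulr_ge0.
Qed.

(** The factor of the reduced Jacobian that multiplies the current: minus the
    derivative of the voltage drops with respect to the squared currents, the line
    flows following the currents through the balance equations. *)
Definition red_loss : 'M[R]_n :=
  diagc r *m diagc r + 2 *: (diagc r *m invmx A2 *m diagc r)
  + diagc x *m diagc x + 2 *: (diagc x *m invmx A2 *m diagc x).

Lemma phi_u_redE u xi i j :
  phi_u_red E r x u xi i j =
    diagc ((Aout R E)^T *m v_node u xi) i j
    + 2 * (pbar u i 0 * (invmx A2 *m diagc r) i j)
    + 2 * (qbar u i 0 * (invmx A2 *m diagc x) i j)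
    - ell u i 0 * ((Aout2 R E)^T *m invmx A2^T *m red_loss) i j.
Proof.
by rewrite /phi_u_red -/red_loss 3!mxDE mxNE !mxZE -!mulmxA !diagc_mulE.
Qed.

(** Every term off the diagonal is a product of nonnegative quantities (flows,
    currents, impedances) and nonpositive inverse incidence matrices. The
    diagonal of red_loss is nonpositive as well because the diagonal of the inverse
    incidence matrix is at most -1, so that g^2 + 2 g (-1) g <= 0. *)
Lemma phi_u_red_Zmatrix u xi :
    (forall k, 0 <= r k 0) -> (forall k, 0 <= x k 0) ->
    phi E r x u xi = 0 -> (forall k, 0 <= ell u k 0) ->
    (forall k, 0 <= p_pq xi k 0 /\ 0 <= q_pq xi k 0) ->
  Zmatrix (phi_u_red E r x u xi).
Proof.
move=> r0 x0 /castmx_eq0 sol L0 s0 i j ij.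
have [balp balq] : - (Ainc R E *m pbar u) - Ain R n *m diagc r *m ell u - p_node u xi = 0
   /\ - (Ainc R E *m qbar u) - Ain R n *m diagc x *m ell u - q_node u xi = 0.
  by have /eqP := sol; rewrite !col_mx_eq0 => /and3P[/eqP-> /eqP->].
have p0 := flow_ge0 r0 L0 (fun k => (s0 k).1) balp.
have q0 := flow_ge0 x0 L0 (fun k => (s0 k).2) balq.
have T0 := invmx_Ainc2_le0 R E_tree; have T1 := invmx_Ainc2_diag R E_tree.
have K0 (g : 'cV[R]_n) m k : (forall k, 0 <= g k 0) ->
    (diagc g *m diagc g + 2 *: (diagc g *m invmx A2 *m diagc g)) m k <= 0.
  move=> g0; rewrite -mulmxA !entryE mul_mx_diag !mxE.
  have [-> /=|mk /=] := eqVneq m k; rewrite ?mulr0n ?mulr1n ?mulr0 ?add0r.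
    have -> : g k 0 * g k 0 + 2 * (g k 0 * (invmx A2 k k * g k 0))
      = g k 0 * g k 0 * (1 + 2 * invmx A2 k k) by ring.
    by rewrite mulr_ge0_le0 ?mulr_ge0//; have := T1 k; lra.
  by do 2!rewrite mulr_ge0_le0//; rewrite mulr_le0_ge0.
have K1 m k : red_loss m k <= 0.
  rewrite /red_loss -addrA mxDE; have := K0 r m k r0; have := K0 x m k x0; lra.
have W0 m k : ((Aout2 R E)^T *m invmx A2^T) m k <= 0.
  rewrite -trmx_inv mxE sumr_le0// => l _.
  by rewrite mxE [(invmx _)^T _ _]mxE mulr_ge0_le0// Aout2_ge0.
have TR (g : 'cV[R]_n) : (forall k, 0 <= g k 0) -> (invmx A2 *m diagc g) i j <= 0.
  by move=> g0; rewrite mul_mx_diag !mxE mulr_le0_ge0.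
rewrite phi_u_redE mxE (negPf ij) mulr0n add0r.
have WK : 0 <= ((Aout2 R E)^T *m invmx A2^T *m red_loss) i j.
  by rewrite mxE sumr_ge0// => k _; rewrite mulr_le0.
have hp := mulr_ge0_le0 (p0 i) (TR r r0); have hq := mulr_ge0_le0 (q0 i) (TR x x0).
have hl := mulr_ge0 (L0 i) WK.
lra.
Qed.

End PowerFlow.

(** * Connectedness and the stability region *)

Section ContinuousMatrix.
Variables (R : realType) (T : topologicalType).

Lemma continuous_bigsum (I : Type) (l : seq I) (P : pred I) (F : I -> T -> R) :
  (forall i, continuous (F i)) -> continuous (fun s => \sum_(i <- l | P i) F i s).
Proof.
move=> cF; elim: l => [|i l IHl].
  by under eq_fun do rewrite big_nil; move=> s; apply: cvg_cst.
under eq_fun do rewrite big_cons; case: (P i) => // s.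
by apply: cvgD; [apply: cF|apply: IHl].
Qed.

Lemma continuous_bigprod (I : Type) (l : seq I) (P : pred I) (F : I -> T -> R) :
  (forall i, continuous (F i)) -> continuous (fun s => \prod_(i <- l | P i) F i s).
Proof.
move=> cF; elim: l => [|i l IHl].
  by under eq_fun do rewrite big_nil; move=> s; apply: cvg_cst.
under eq_fun do rewrite big_cons; case: (P i) => // s.
by apply: cvgM; [apply: cF|apply: IHl].
Qed.

Lemma continuous_det n (F : T -> 'M[R]_n) :
  (forall i j, continuous (fun s => F s i j)) -> continuous (fun s => \det (F s)).
Proof.
move=> cF; apply: continuous_bigsum => p s.
by apply: cvgM; [apply: cvg_cst|apply: continuous_bigprod].
Qed.

Lemma continuous_adj n (F : T -> 'M[R]_n) i j :
  (forall i j, continuous (fun s => F s i j)) -> continuous (fun s => (\adj (F s)) i j).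
Proof.
move=> cF; under eq_fun do rewrite mxE /cofactor.
move=> s; apply: cvgM; first exact: cvg_cst.
by apply: continuous_det => i' j'; under eq_fun do rewrite !mxE; apply: cF.
Qed.

(** Semipositivity is open by continuity of F t *m y. For invertible Z-matrices it
    is equivalent to nonnegativity of the inverse; multiplied by the squared determinant,
    the inverse becomes det * adj, which is continuous everywhere, and so the
    condition is also closed. *)
Lemma semipositive_component n (F : T -> 'M[R]_n) (S : set T) (s0 : T) :
    (forall i j, continuous (fun s => F s i j)) ->
    (forall s, S s -> Zmatrix (F s) /\ F s \in unitmx) ->
    semipositive (F s0) ->
  forall s, connected_component S s0 s -> semipositive (F s).
Proof.
move=> cF ZS sp0 s [C [Cs0 CS Cconn] Cs].
suff CE : C `&` [set t | semipositive (F t)] = C by move: Cs; rewrite -CE => -[].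
apply: Cconn.
- by exists s0.
- exists [set t | semipositive (F t)] => //.
  rewrite openE => t [y y0 Fy].
  suff : \forall t' \near t, forall i, 0 < (F t' *m y) i 0.
    by apply: filterS => t' Fty; exists y.
  apply: filter_forall => i.
  have cFy : continuous (fun t => (F t *m y) i 0).
    under eq_fun do rewrite mxE.
    apply: continuous_bigsum => j {Fy}t.
    by apply: cvgM; [apply: cF|apply: cvg_cst].
  exact: (cvgr_gt _ (cFy t)).
- exists (\bigcap_(ij in [set: 'I_n * 'I_n])
      [set t | 0 <= \det (F t) * \adj (F t) ij.1 ij.2]).
    apply: closed_bigI => -[i j] _ /=.
    apply: (@preimage_closed _ _ (fun t => \det (F t) * \adj (F t) i j) [set z | 0 <= z]).
      move=> t _; apply: cvgM; [exact: continuous_det|exact: continuous_adj].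
    exact: closed_ge.
  have adjE t i j : F t \in unitmx ->
      \det (F t) * \adj (F t) i j = \det (F t) ^+ 2 * invmx (F t) i j.
    move=> Fu; rewrite /invmx Fu mxZE expr2 -mulrA mulVKf//.
    by rewrite -unitfE -unitmxE.
  apply/seteqP; split => t [Ct Ft]; split => //=; have [Zt ut] := ZS t (CS t Ct).
    move=> [i j] _ /=; rewrite adjE// mulr_ge0 ?sqr_ge0//.
    apply: (monotone_rinv_ge0 (Z_semipositive_monotone Zt Ft)).
    exact: mulmxV.
  apply: invmx_ge0_semipositive => // i j; have := Ft (i, j) I.
  rewrite /= adjE// pmulr_rge0// lt_neqAle sqr_ge0 andbT eq_sym sqrf_eq0.
  by rewrite -unitfE -unitmxE.
Qed.

End ContinuousMatrix.

Section Region.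
Variables (R : realType) (n : nat) (E : rel 'I_n.+1).
Hypothesis E_tree : rooted_tree E.
Variables (r x : 'cV[R]_n).
Local Notation state := ('cV[R]_(dim_u n) * 'cV[R]_(dim_xi n))%type.

Lemma continuous_phi_u_red i j :
  continuous (fun s : state => phi_u_red E r x s.1 s.2 i j).
Proof.
have cu k : continuous (fun s : state => s.1 k 0).
  move=> s; have c : {for s, continuous (@fst 'cV[R]_(dim_u n) 'cV[R]_(dim_xi n))}
    by apply: cvg_fst.
  exact: (continuous_comp c (@coord_continuous R _ _ k 0 _)).
have cxi k : continuous (fun s : state => s.2 k 0).
  move=> s; have c : {for s, continuous (@snd 'cV[R]_(dim_u n) 'cV[R]_(dim_xi n))}
    by apply: cvg_snd.
  exact: (continuous_comp c (@coord_continuous R _ _ k 0 _)).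
have cp : continuous (fun s : state => pbar s.1 i 0).
  by under eq_fun do rewrite !mxE; apply: cu.
have cq : continuous (fun s : state => qbar s.1 i 0).
  by under eq_fun do rewrite !mxE; apply: cu.
have cl : continuous (fun s : state => ell s.1 i 0).
  by under eq_fun do rewrite !mxE; apply: cu.
have cv k : continuous (fun s : state => v_node s.1 s.2 k 0).
  case: (unliftP ord0 k) => [m|] ->.
    by under eq_fun do rewrite col_mx_lift !mxE; apply: cu.
  by under eq_fun do rewrite col_mx_ord0 !mxE; apply: cxi.
under eq_fun do rewrite phi_u_redE.
have cM (c : R) (f : state -> R) : continuous f -> continuous (fun s => f s * c).
  by move=> cf s; apply: cvgM; [apply: cf|apply: cvg_cst].
have cM2 (f : state -> R) : continuous f -> continuous (fun s => 2 * f s).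
  by move=> cf s; apply: cvgM; [apply: cvg_cst|apply: cf].
move=> s; apply: cvgB; last exact: cM.
apply: cvgD; last exact/cM2/cM.
apply: cvgD; last exact/cM2/cM.
case: (eqVneq i j) => [->|ij]; last first.
  by under eq_fun do rewrite mxE (negPf ij) mulr0n; rewrite mxE (negPf ij); apply: cvg_cst.
rewrite !mxE eqxx mulr1n.
under eq_fun do rewrite !mxE eqxx mulr1n.
move: s; apply: continuous_bigsum => k s.
apply: cvgM; [apply: cvg_cst|exact: cv].
Qed.

Lemma phi_u_red_flat : semipositive (phi_u_red E r x (flat_u R n) (flat_xi R n)).
Proof.
have v1 : v_node (flat_u R n) (flat_xi R n) = const_mx 1.
  apply/colP => i; rewrite [RHS]mxE; case: (unliftP ord0 i) => [m|] ->.
    by rewrite col_mx_lift /v_pq !col_mxKd col_mxKu mxE.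
  by rewrite col_mx_ord0 /v_root col_mxKu mxE.
have p0 : pbar (flat_u R n) = 0 by rewrite /pbar col_mxKu.
have q0 : qbar (flat_u R n) = 0 by rewrite /qbar col_mxKd col_mxKu.
have l0 : ell (flat_u R n) = 0 by rewrite /ell !col_mxKd col_mxKu.
exists (const_mx 1) => i; first by rewrite mxE.
have -> : phi_u_red E r x (flat_u R n) (flat_xi R n) = diagc ((Aout R E)^T *m const_mx 1).
  by apply/matrixP => a b; rewrite phi_u_redE p0 q0 l0 v1 !mxE; ring.
rewrite diagc_mulE [const_mx _ _ _]mxE mulr1.
have [|k Ek] := has_parent E_tree (j := lift ord0 i); first by rewrite eq_sym neq_lift.
rewrite mxE; under eq_bigr do rewrite !mxE.
by rewrite (sum_parent (R := R) E_tree (fun=> 1) Ek).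
Qed.

End Region.

Theorem theorem10 (R : realType) (n : nat) (n_ge1 : (0 < n)%N)
    (E : rel 'I_n.+1) (E_tree : rooted_tree E)
    (r x : 'cV[R]_n)
    (r_ge0 : forall k, 0 <= r k 0) (x_ge0 : forall k, 0 <= x k 0)
    (u : 'cV[R]_(dim_u n)) (xi : 'cV[R]_(dim_xi n))
    (in_region : stability_region E r x (u, xi))
    (loads : forall k, 0 < p_pq xi k 0 /\ 0 < q_pq xi k 0) :
  let M := phi_u_red E r x u xi in
  let rho := spectral_radius (invmx (diag_part M) *m off_part M) in
  (0 < \det M /\ 0 < det_approx M /\ rho < 1) /\
  VSI M <= VSIA M /\ VSIA M <= VSI M - rho * ln (1 - rho).
Proof.
pose F (s : 'cV[R]_(dim_u n) * 'cV[R]_(dim_xi n)) := phi_u_red E r x s.1 s.2.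
have FS s : regular_load_solutions E r x s -> Zmatrix (F s) /\ F s \in unitmx.
  move=> [sol [_ [_ [l0 [s0 detJ]]]]].
  by split; [apply: phi_u_red_Zmatrix|apply: phi_u_red_unit].
have spM : semipositive (phi_u_red E r x u xi).
  apply: (semipositive_component (F := F) _ FS _ in_region).
    by move=> i j; apply: continuous_phi_u_red.
  exact: phi_u_red_flat.
have [ZM _] := FS _ (connected_component_sub in_region).
rewrite /F /= in ZM.
move: (phi_u_red E r x u xi) spM ZM => M spM ZM {in_region FS F loads}.
exact: (Z_semipositive_VSI n_ge1 ZM spM).
Qed.
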